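(* Let $R$ be a ring. Then $R$ is strongly NUS-nil clean if and only if $a^4-a^2\in \mathrm{Nil}(R)$ for every $a\in R$ with $a\notin U(R)$.
   Context: All rings are associative with identity, not necessarily commutative. $U(R)$ is the set of invertible elements of $R$ and $\mathrm{Nil}(R)$ is the set of nilpotent elements of $R$. An element $e\in R$ is square-idempotent if $e^2=e^4$. An element $a\in R$ is strongly square-nil clean if $a=e+n$ with $e\in R$ square-idempotent, $n\in R$ nilpotent and $en=ne$. A ring $R$ is strongly NUS-nil clean if every non-invertible element of $R$ is strongly square-nil clean. *)

(* Defs.v *)
From HB Require Import structures.
From mathcomp Require Import all_boot all_order all_algebra.

Set Implicit Arguments.
Unset Strict Implicit.
Unset Printing Implicit Defensive.

Import GRing.Theory.
Local Open Scope ring_scope.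

(* U(R).  GRing.unit needs a unitRingType, which excludes the zero ring and
   carries a boolean test for invertibility; this version needs neither. *)
Definition invertible (R : pzRingType) (a : R) : Prop :=
  exists b : R, a * b = 1 /\ b * a = 1.

(* Nil(R).  The exponent 0 adds nothing: a ^+ 0 = 0 only in the zero ring. *)
Definition nilpotent (R : pzRingType) (a : R) : Prop :=
  exists k : nat, a ^+ k = 0.

Definition square_idempotent (R : pzRingType) (e : R) : Prop :=
  e ^+ 2 = e ^+ 4.

Definition strongly_square_nil_clean (R : pzRingType) (a : R) : Prop :=
  exists e n : R,
    [/\ a = e + n, square_idempotent e, nilpotent n & e * n = n * e].

Definition strongly_NUS_nil_clean (R : pzRingType) : Prop :=
  forall a : R, ~ invertible a -> strongly_square_nil_clean a.

(* Main.v *)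
Require Import Defs.
From HB Require Import structures.
From mathcomp Require Import all_boot all_order all_algebra.
From mathcomp Require Import ring.

Set Implicit Arguments.
Unset Strict Implicit.
Unset Printing Implicit Defensive.

Import GRing.Theory.
Local Open Scope ring_scope.

(** The left-to-right direction is divisibility: if [a = e + n] with [e] and
    [n] commuting, then [a - e = n] divides [a ^+ 4 - e ^+ 4] and
    [a ^+ 2 - e ^+ 2], and [e ^+ 4 = e ^+ 2], so [n] divides
    [a ^+ 4 - a ^+ 2].

    For the converse, let [a] be non-invertible.  Then [a *+ 2] is also
    non-invertible, and comparing the hypothesis at [a] and at [a *+ 2] shows
    that [12 a^2], hence [6 a], is nilpotent.  All further computations take
    place among integer polynomials in [a].  Up to nilpotents, [a ^+ 2] and
    [b = 2 (a^2 - a)] are idempotent and [a = a^2 (1 - 2 b)].  To see this, note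
    that [a] is supported, up to nilpotents, where [6] is nilpotent, and split
    there: where [2] is nilpotent, [a] is itself idempotent and [b] vanishes;
    where [3] is nilpotent, [a] is tripotent, and [b] is the idempotent
    [(a^2 - a) / 2] that cuts out the eigenvalue [-1].  Lifting [a ^+ 2] and [b]
    to commuting idempotents [f] and [g] gives [e = f (1 - 2 g)], whose square
    is [f] because [(1 - 2 g)^2 = 1]; so [e] is square-idempotent, and [a - e]
    is nilpotent.  The lifting step is [idempotent_lift], the passage from [b] to
    [e] is [strongly_square_nil_clean_of_approx], and the properties of [b] are
    checked in [strongly_square_nil_clean_of_12]. *)

(** * Nilpotents among commuting elements *)

Lemma nilpotentM_comm (R : pzRingType) (x y : R) :
  GRing.comm x y -> nilpotent x -> nilpotent (x * y).
Proof. by move=> cxy [k xk0]; exists k; rewrite exprMn_comm // xk0 mul0r. Qed.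

Lemma nilpotentD_comm (R : pzRingType) (x y : R) :
  GRing.comm x y -> nilpotent x -> nilpotent y -> nilpotent (x + y).
Proof.
move=> cxy [k xk0] [l yl0]; exists (k + l)%N.
rewrite exprDn_comm // big1 // => i _.
(* In each term x ^+ (k + l - i) * y ^+ i, one of the two exponents is large
   enough. *)
have [le_li|lt_il] := leqP l i.
  by rewrite -(subnK le_li) exprD yl0 mulr0 mulr0 mul0rn.
have -> : x ^+ (k + l - i) = 0 by rewrite -addnBA ?exprD ?xk0 ?mul0r // ltnW.
by rewrite mul0r mul0rn.
Qed.

Lemma nilpotent_of_sqr (R : pzRingType) (x : R) :
  nilpotent (x ^+ 2) -> nilpotent x.
Proof. by case=> k xk0; exists (2 * k)%N; rewrite exprM. Qed.

Lemma strongly_square_nil_clean_nilpotent (R : pzRingType) (a : R) :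
  strongly_square_nil_clean a -> nilpotent (a ^+ 4 - a ^+ 2).
Proof.
move=> [e [n [a_en e24 nil_n cen]]].
have cae : GRing.comm a e by rewrite a_en; apply/commr_sym/commrD.
have cna : GRing.comm n a by rewrite a_en; apply: commrD.
have n_ae : a - e = n by rewrite a_en addrC addKr.
have -> : a ^+ 4 - a ^+ 2 = (a ^+ 4 - e ^+ 4) - (a ^+ 2 - e ^+ 2).
  by rewrite -e24 opprB addrA subrK.
rewrite !subrXX_comm // n_ae -mulrBr.
apply: nilpotentM_comm => //; apply: commrB; apply: commr_sum => i _;
  by apply: commrM; apply: commrX.
Qed.

(** * Lifting idempotents in a commutative ring *)

(** One Newton step for [f^2 - f], namely [f := 3 f^2 - 2 f^3], squares the
    defect [f^2 - f], up to a factor, while moving [f] by a multiple of it. *)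
Lemma idempotent_approx (S : comNzRingType) (x : S) (n : nat) :
  exists f c d : S,
    f ^+ 2 - f = c * (x ^+ 2 - x) ^+ n.+1 /\ f - x = d * (x ^+ 2 - x).
Proof.
elim: n => [|n [f [c [d [fc fd]]]]]; first by exists x, 1, 0; split; ring.
set y := x ^+ 2 - x in fc fd *.
exists (3 * f ^+ 2 - 2 * f ^+ 3).
exists ((4 * (f ^+ 2 - f) - 3) * c ^+ 2 * y ^+ n).
exists (d + (1 - 2 * f) * c * y ^+ n); split.
  transitivity ((4 * (f ^+ 2 - f) - 3) * (f ^+ 2 - f) ^+ 2); first by ring.
  by rewrite fc !exprS; ring.
transitivity ((f - x) + (1 - 2 * f) * (f ^+ 2 - f)); first by ring.
by rewrite fc fd exprS; ring.
Qed.

(** * Square-idempotents in the image of a commutative ring *)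

(** A commutative ring mapping to [R] gives access to commutative algebra in
    [R]: the elements with nilpotent image form a radical ideal. *)
Section CommutativeImage.

Variables (S : comNzRingType) (R : pzRingType) (phi : {rmorphism S -> R}).

Lemma comm_rmorph (s t : S) : GRing.comm (phi s) (phi t).
Proof. by rewrite /GRing.comm -!rmorphM mulrC. Qed.

Lemma nilpotent_rmorphD (s t : S) :
  nilpotent (phi s) -> nilpotent (phi t) -> nilpotent (phi (s + t)).
Proof. by rewrite rmorphD; apply: nilpotentD_comm; apply: comm_rmorph. Qed.

Lemma nilpotent_rmorphM (s t : S) :
  nilpotent (phi t) -> nilpotent (phi (s * t)).
Proof.
by rewrite mulrC rmorphM; apply: nilpotentM_comm; apply: comm_rmorph.
Qed.

Lemma nilpotent_rmorph_sqr (s : S) :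
  nilpotent (phi (s ^+ 2)) -> nilpotent (phi s).
Proof. by rewrite rmorphXn; apply: nilpotent_of_sqr. Qed.

Lemma idempotent_lift (x : S) :
  nilpotent (phi (x ^+ 2 - x)) ->
  exists f : S, phi f ^+ 2 = phi f /\ nilpotent (phi (f - x)).
Proof.
move=> nil_x; have [k xk0] := nil_x.
have [f [c [d [fc fd]]]] := idempotent_approx x k.
exists f; split; last by rewrite fd; apply: nilpotent_rmorphM.
apply/eqP; rewrite -subr_eq0 -rmorphXn -rmorphB fc.
by rewrite rmorphM rmorphXn exprS xk0 !mulr0.
Qed.

(** Any approximate factorization [x = x^2 (1 - 2 b)] with [x^2] and [b]
    approximately idempotent gives a clean decomposition, since the square of
    [f (1 - 2 g)] is [f] for commuting idempotents [f] and [g]. *)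
Lemma strongly_square_nil_clean_of_approx (x b : S) :
  nilpotent (phi (x ^+ 4 - x ^+ 2)) ->
  nilpotent (phi (b ^+ 2 - b)) ->
  nilpotent (phi (x - x ^+ 2 * (1 - 2 * b))) ->
  strongly_square_nil_clean (phi x).
Proof.
move=> nil_x nil_b nil_xb.
have [|f [ff nil_f]] := @idempotent_lift (x ^+ 2); first by rewrite -exprM.
have [g [gg nil_g]] := idempotent_lift nil_b.
set e := f * (1 - 2 * g).
have e2 : phi e ^+ 2 = phi f.
  have -> : phi e ^+ 2 = phi (f ^+ 2 + 4 * f ^+ 2 * (g ^+ 2 - g)).
    by rewrite -rmorphXn; congr (phi _); rewrite /e; ring.
  rewrite rmorphD [phi (_ * _)]rmorphM (rmorphB phi (g ^+ 2)) !(rmorphXn phi 2).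
  by rewrite gg subrr mulr0 addr0.
exists (phi e), (phi (x - e)); split.
- by rewrite -rmorphD addrC subrK.
- by rewrite /square_idempotent (exprM _ 2 2) e2 ff.
- have -> : x - e = (x - x ^+ 2 * (1 - 2 * b))
                    + ((2 * b - 1) * (f - x ^+ 2) + 2 * f * (g - b)).
    by rewrite /e; ring.
  by do 2?apply: nilpotent_rmorphD => //; apply: nilpotent_rmorphM.
- exact: comm_rmorph.
Qed.

(** The multiplier [2] in [b := 2 (x^2 - x)] stands for [1 / 2]: the difference
    is immaterial once [6 x] is nilpotent, because [2] is congruent to [1 / 2]
    modulo [3], while modulo [2] the choice [b = 0] is right: there [x^2 - x] is
    nilpotent, its square being [x^4 - x^2]. *)
Lemma strongly_square_nil_clean_of_12 (x : S) :
  nilpotent (phi (x ^+ 4 - x ^+ 2)) -> nilpotent (phi (12 * x ^+ 2)) ->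
  strongly_square_nil_clean (phi x).
Proof.
set u := x ^+ 4 - x ^+ 2 => nil_u nil_12.
have nil_6 : nilpotent (phi (6 * x)).
  apply: nilpotent_rmorph_sqr.
  have -> : (6 * x) ^+ 2 = 3 * (12 * x ^+ 2) by ring.
  exact: nilpotent_rmorphM.
(* The next two elements measure how far [x] is from being tripotent, and how far
   it is from being idempotent away from the prime 3. *)
have nil_t : nilpotent (phi (x ^+ 3 - x)).
  apply: nilpotent_rmorph_sqr.
  have -> : (x ^+ 3 - x) ^+ 2 = (x ^+ 2 - 1) * u by rewrite /u; ring.
  exact: nilpotent_rmorphM.
have nil_s : nilpotent (phi (3 * (x ^+ 2 - x))).
  apply: nilpotent_rmorph_sqr.
  have -> : (3 * (x ^+ 2 - x)) ^+ 2 = 9 * u + (3 * x - 3 * x ^+ 2) * (6 * x).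
    by rewrite /u; ring.
  by apply: nilpotent_rmorphD; apply: nilpotent_rmorphM.
apply: (@strongly_square_nil_clean_of_approx x (2 * (x ^+ 2 - x))) => //.
  have -> : (2 * (x ^+ 2 - x)) ^+ 2 - 2 * (x ^+ 2 - x)
            = 4 * u + ((x - 1) * (6 * x) + (- 8) * (x ^+ 3 - x)).
    by rewrite /u; ring.
  by do 2?apply: nilpotent_rmorphD; apply: nilpotent_rmorphM.
have -> : x - x ^+ 2 * (1 - 2 * (2 * (x ^+ 2 - x)))
          = 4 * u + ((- 4) * (x ^+ 3 - x) + 3 * (x ^+ 2 - x)).
  by rewrite /u; ring.
by do 2?apply: nilpotent_rmorphD => //; apply: nilpotent_rmorphM.
Qed.

End CommutativeImage.

(** * Evaluating integer polynomials at a ring element *)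

Lemma int_poly_eval (R : pzRingType) (a : R) :
  (1 : R) != 0 -> exists phi : {rmorphism {poly int} -> R}, phi 'X = a.
Proof.
move=> nz1.
pose nzR : nzRingType :=
  HB.pack (GRing.PzRing.sort R) (GRing.PzSemiRing_isNonZero.Build R nz1).
have comm_int : commr_rmorph (intr : int -> nzR) (a : nzR).
  by move=> m; apply: commr_int.
pose phi : {rmorphism {poly int} -> nzR} := horner_morph comm_int.
by exists phi; apply: (horner_morphX comm_int).
Qed.

Lemma not_invertible_double (R : pzRingType) (a : R) :
  ~ invertible a -> ~ invertible (a *+ 2).
Proof.
move=> nua [c [ac1 ca1]]; apply: nua; exists (c *+ 2).
by rewrite mulrnAr -mulrnAl ac1 mulrnAl -mulrnAr ca1.
Qed.

Theorem theorem2p6 (R : pzRingType) :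
  strongly_NUS_nil_clean R <->
  (forall a : R, ~ invertible a -> nilpotent (a ^+ 4 - a ^+ 2)).
Proof.
split=> [cleanR a nua | nilR a nua].
  exact/strongly_square_nil_clean_nilpotent/cleanR.
have nz1 : (1 : R) != 0.
  apply/eqP => R0; apply: nua; exists 0.
  by rewrite mulr0 mul0r R0.
have [phi phiX] := int_poly_eval a nz1.
have nil_u : nilpotent (phi ('X ^+ 4 - 'X ^+ 2)).
  by rewrite rmorphB !rmorphXn phiX; apply: nilR.
have nil_v : nilpotent (phi (('X *+ 2) ^+ 4 - ('X *+ 2) ^+ 2)).
  by rewrite rmorphB !rmorphXn rmorphMn phiX; apply/nilR/not_invertible_double.
rewrite -phiX; apply: strongly_square_nil_clean_of_12 => //.
have -> : 12 * 'X ^+ 2 = (('X *+ 2) ^+ 4 - ('X *+ 2) ^+ 2)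
                         + (- 16) * ('X ^+ 4 - 'X ^+ 2) :> {poly int} by ring.
by apply: nilpotent_rmorphD => //; apply: nilpotent_rmorphM.
Qed.
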